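(* Let $K>0$ be as in the context and let $B\sim\mathcal N(-\sigma^2,2\sigma^2)$. Over $\ell>0$ and $\sigma^2>0$, the limiting efficiency $$\mathrm{Eff}(\ell,\sigma^2)=\sigma^2\,\ell^2\,\alpha(\ell,\sigma^2),\qquad \alpha(\ell,\sigma^2)=2E\left\{\Phi\left(\frac{B}{\ell^3K}-\frac{\ell^3K}{2}\right)\right\},$$ is maximized at $\ell_{\mathrm{opt}}\approx 1.125\,K^{-1/3}$ and $\sigma^2_{\mathrm{opt}}\approx 3.038$, at which point the limiting acceptance rate is $\alpha_{\mathrm{opt}}=\alpha(\ell_{\mathrm{opt}},\sigma^2_{\mathrm{opt}})\approx 15.47\%$ (numerical values correct to the digits displayed).
   Context: $\Phi$ is the standard normal distribution function. $K=\left[\frac{1}{48}E\{5g'''(X)^2-3g''(X)^3\}\right]^{1/2}>0$, where $X$ has density $f=e^g$ on $\mathbb{R}$, $g$ and its first eight derivatives are bounded in absolute value by a polynomial, and $f$ has finite moments of all orders; only the fact that $K$ is a positive constant not depending on $(\ell,\sigma^2)$ matters here. Origin of the quantities: in the idealized particle Langevin algorithm on the product target $\prod_{i=1}^n f(x_i)$ with proposal scaling $\lambda_n=\ell n^{-1/6}$, and with additive noise in the log target that is $V^n\sim\mathcal N(-\frac12\sigma^2,\sigma^2)$ at the proposed value and, independently and at stationarity, $W^n\sim\mathcal N(\frac12\sigma^2,\sigma^2)$ at the current value (so $B^n=V^n-W^n\sim\mathcal N(-\sigma^2,2\sigma^2)$), $\alpha(\ell,\sigma^2)$ is the $n\to\infty$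 limit of the expected acceptance rate, and $\ell^2\alpha(\ell,\sigma^2)$ is the limit of $n^{-2/3}J_n(\ell,\sigma^2)$, with $J_n$ the expected squared jump distance. Computational cost is taken to be inversely proportional to $\sigma^2$, so efficiency is (up to a constant) $\sigma^2J_n(\ell,\sigma^2)$; here it is understood in the limit $n\to\infty$ after multiplication by $n^{-2/3}$. *)

(* Defs.v *)
From HB Require Import structures.
From mathcomp Require Import all_boot all_order all_algebra.
From mathcomp Require Import all_classical all_reals all_analysis.

Set Implicit Arguments.
Unset Strict Implicit.
Unset Printing Implicit Defensive.

Import Order.TTheory GRing.Theory Num.Theory.
Import numFieldNormedType.Exports.

Local Open Scope classical_set_scope.
Local Open Scope ring_scope.

Definition Phi (R : realType) (x : R) : R :=
  fine (normal_prob (0 : R) 1 `]-oo, x]).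

(* The expectation over B ~ N(-s2, 2 s2) is taken under the law of B itself.
   [normal_prob] is parameterized by the standard deviation, hence the square
   root of the variance 2 s2 as its second argument. The integrand takes values
   in [0, 1], so [fine] discards nothing. *)
Definition alpha (R : realType) (K l s2 : R) : R :=
  2 * fine ('E_(normal_prob (- s2) (Num.sqrt (2 * s2)))
              [(fun b : R => Phi (b / (l ^+ 3 * K) - l ^+ 3 * K / 2))])%E.

Definition Eff (R : realType) (K l s2 : R) : R :=
  s2 * l ^+ 2 * alpha K l s2.

(* Main.v *)
Require Import Defs.
From HB Require Import structures.
From mathcomp Require Import all_boot all_order all_algebra.
From mathcomp Require Import all_classical all_reals all_analysis.
From mathcomp Require Import measurable_realfun ring lra.

Set Implicit Arguments.
Unset Strict Implicit.
Unset Printing Implicit Defensive.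

Import Order.TTheory GRing.Theory Num.Theory.
Import numFieldNormedType.Exports.

Local Open Scope ring_scope.

(** If [x = l ^+ 3 * K], then [alpha] is twice the probability that
    [Z - B / x <= - x / 2] with [Z] standard normal independent of [B]. Since
    [Z - B / x] is normal with mean [s2 / x] and variance [1 + 2 s2 / x ^+ 2],
    this gives [alpha = 2 Phi (- w)] where [4 w ^+ 2 = x ^+ 2 + 2 s2].

    For fixed [w], AM-GM bounds [s2 ^+ 3 * x ^+ 2] by [27 / 8 * w ^+ 8], with
    equality only at [x = w], [s2 = 3 / 2 * w ^+ 2]; hence [Eff ^+ 3] is at most
    [27 / K ^+ 2 * w ^+ 8 * Phi (- w) ^+ 3]. This function of [w] increases, then
    decreases, its critical point being the unique positive root [u] of
    [gap u = u * phi u - 8 / 3 * Phi (- u)]: [gap] increases while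
    [u ^+ 2 <= 8 / 3], and is positive beyond by Mills' inequality
    [Phi (- u) <= phi u / u].

    The root is located with alternating Taylor bounds for [exp (- y)], for the
    Gaussian integral over [[0, u]], and for [cos] (which bounds [pi]). *)

(** * Normal laws and the expectation of [Phi] at an affine function of a normal variable *)

Section normal_law.
Context {R : realType}.
Local Open Scope classical_set_scope.
Implicit Types (a b m s x y z : R).
Notation mu := (@lebesgue_measure R).

Lemma integral_affineNy (G : R -> R) (k c b : R) : 0 < k -> continuous G ->
  (forall x, 0 <= G x) ->
  (\int[mu]_(x in `]-oo, (k * b + c)%R]) (G x)%:E =
   \int[mu]_(x in `]-oo, b]) (G (k * x + c) * k)%R%:E)%E.
Proof.
move=> k0 cG G0; pose F (x : R) := k * x + c.
have dF (x : R) : is_derive x 1 F k.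
  by rewrite /F; apply: is_derive_eq; rewrite addr0 -[LHS]/(k * 1) mulr1.
have F' : F^`() = cst k by apply/funext => x; rewrite derive1E derive_val.
have cF : continuous F.
  move=> x; apply/differentiable_continuous/derivable1_diffP.
  exact: ex_derive.
rewrite -[k * b + c]/(F b) increasing_ge0_integration_by_substitutionNy ?F'//.
- by move=> x y _ _ xy; rewrite /F ltrD2r ltr_pM2l.
- by move=> x _; exact: cvg_cst.
- exact: is_cvg_cst.
- exact: cvg_cst.
- split; first by move=> x _; exact: ex_derive.
  exact/cvg_at_left_filter/cF.
- apply: cvg_comp (cvg_addrr_Ny c); apply/gt0_cvgMrNy => //; exact: cvg_id.
- exact: continuous_subspaceT.
Qed.

Lemma normal_pdf_gt0E m s x : 0 < s -> normal_pdf m s x =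
  (s * Num.sqrt (2 * pi))^-1 * expR (- ((x - m) / s) ^+ 2 / 2).
Proof.
move=> s0; rewrite normal_pdfE ?gt_eqF// /normal_peak /normal_fun.
congr (_^-1 * expR _).
  rewrite -mulrnAr sqrtrM ?sqr_ge0// sqrtr_sqr gtr0_norm//.
  by congr (_ * Num.sqrt _); rewrite mulr_natl.
by field; rewrite gt_eqF.
Qed.

Lemma normal_prob_itvNy m s x : 0 < s ->
  normal_prob m s `]-oo, x] = normal_prob 0 1 `]-oo, ((x - m) / s)].
Proof.
move=> s0; rewrite /normal_prob.
have -> : (x - m) / s = s^-1 * x + (- m / s) by field; rewrite gt_eqF.
rewrite integral_affineNy ?invr_gt0//; last 2 first.
- by apply: continuous_normal_pdf; rewrite oner_eq0.
- by move=> y; exact: normal_pdf_ge0.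
apply: eq_integral => y _; rewrite !normal_pdf_gt0E//; congr EFin.
have -> : (s^-1 * y + - m / s - 0) / 1 = (y - m) / s by field; rewrite gt_eqF.
have sq0 : Num.sqrt (2 * pi) != 0 :> R.
  by rewrite sqrtr_eq0 -ltNge mulr_gt0 ?pi_gt0.
by field; rewrite sq0 gt_eqF.
Qed.

(** Moves [x] from the domain into the integrand, so that the domain is a fixed half-line when the
    order of integration is exchanged. *)
Lemma normal_prob_itvNy_shift x :
  normal_prob 0 1 `]-oo, x] =
  (\int[mu]_(z in `]-oo, 0%R]) (normal_pdf 0 1 (z + x)%R)%:E)%E.
Proof.
have -> : `]-oo, x] = `]-oo, (1 * 0 + x)] :> set R by rewrite mul1r add0r.
rewrite /normal_prob integral_affineNy//; last 2 first.
- by apply: continuous_normal_pdf; rewrite oner_eq0.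
- by move=> y; exact: normal_pdf_ge0.
by apply: eq_integral => y _; rewrite mul1r mulr1.
Qed.


(** The Radon-Nikodym derivative of the law agrees almost everywhere with [normal_pdf], both having
    the same integral over every measurable set. Boundedness of [f] makes it integrable for the
    probability. *)
Lemma integral_normal_prob m s (f : R -> R) : s != 0 ->
  measurable_fun setT f -> (forall x, 0 <= f x <= 1) ->
  (\int[normal_prob m s]_x (f x)%:E =
   \int[mu]_x (f x * normal_pdf m s x)%:E)%E.
Proof.
move=> s0 mf f01.
have intf : (normal_prob m s).-integrable setT (EFin \o f).
  apply: (@le_integrable _ _ _ _ _ _ _ (cst 1%E)) => //.
  - exact/measurable_EFinP.
  - move=> x _; have /andP[f0 f1] := f01 x.
    by rewrite /= lee_fin !ger0_norm.
  - exact: finite_measure_integrable_cst.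
rewrite -(Radon_Nikodym_change_of_variables (normal_prob_dominates m s))//=.
under [RHS]eq_integral do rewrite EFinM.
apply: ae_eq_integral => //.
- apply: emeasurable_funM; first exact/measurable_EFinP.
  apply: (measurable_int mu).
  by apply: Radon_Nikodym_integrable; exact: normal_prob_dominates.
- apply: emeasurable_funM; apply/measurable_EFinP => //.
  exact: measurable_normal_pdf.
- apply: ae_eqe_mul2l => /=.
  rewrite Radon_NikodymE//=; first exact: normal_prob_dominates.
  move=> dom; case: cid => /= h [h1 h2 h3].
  apply: integral_ae_eq => //=.
  + by apply/measurable_EFinP; exact: measurable_normal_pdf.
  + by move=> E _ mE; rewrite -h3.
Qed.

(** Completing the square in [y]: for [Z] standard normal independent of [Y], the joint density of
    [Y] and [Z - (a + b * Y)] is the marginal density of the latter times the conditional density of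
    [Y]. *)
Lemma normal_pdf_mul a b m s y z : 0 < s ->
  let t := Num.sqrt (1 + (b * s) ^+ 2) in
  normal_pdf 0 1 (z + (a + b * y)) * normal_pdf m s y =
  normal_pdf (- (a + b * m)) t z *
  normal_pdf ((m - b * s ^+ 2 * (z + a)) / t ^+ 2) (s / t) y.
Proof.
move=> s0 t.
have t2 : t ^+ 2 = 1 + (b * s) ^+ 2 by rewrite sqr_sqrtr// addr_ge0// sqr_ge0.
have t0 : 0 < t by rewrite sqrtr_gt0 ltr_pwDl// sqr_ge0.
rewrite !normal_pdf_gt0E// ?divr_gt0// mulrACA [RHS]mulrACA -!expRD.
have sq0 : Num.sqrt (2 * pi) != 0 :> R.
  by rewrite sqrtr_eq0 -ltNge mulr_gt0 ?pi_gt0.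
congr (_ * expR _); first by field; rewrite sq0 !gt_eqF.
have t20 : 1 + (b * s) ^+ 2 != 0 by rewrite -t2 expf_neq0// gt_eqF.
rewrite subr0 divr1 !exprMn !exprVn !exprMn !exprVn t2.
by field; rewrite t20 gt_eqF.
Qed.

(** Seen as a random variable, the identity has [Phi] as its distribution function; this yields
    monotonicity and the limit at minus infinity. *)
Let idR : measurableTypeR R -> R := idfun.

#[local] HB.instance Definition _ :=
  @isMeasurableFun.Build _ _ _ _ idR (@measurable_id _ _ setT).

Let PhiE x : @Phi R x = fine (cdf (idR : {RV normal_prob 0 1 >-> R}) x).
Proof. by rewrite /Phi /cdf /distribution /pushforward preimage_id. Qed.

Lemma Phi_nondecreasing : {homo @Phi R : x y / x <= y}.
Proof.
move=> x y xy; rewrite !PhiE fine_le ?fin_num_measure//.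
exact: cdf_nondecreasing.
Qed.

Lemma measurable_Phi : measurable_fun setT (@Phi R).
Proof.
by apply: nondecreasing_measurable => // x y; exact: Phi_nondecreasing.
Qed.

Lemma cvg_PhiNy : @Phi R x @[x --> -oo] --> 0.
Proof.
rewrite (funext PhiE); apply: fine_cvg; exact: cvg_cdfNy0.
Qed.

Lemma Phi_ge0_le1 x : 0 <= @Phi R x <= 1.
Proof.
rewrite /Phi fine_ge0//=.
by rewrite -lee_fin fineK ?fin_num_measure// probability_le1.
Qed.

(* [Phi (a + b Y)] is the probability that [Z - b Y <= a] for a standard normal
   [Z] independent of [Y], and [Z - b Y] is again normal. *)
Lemma expectation_Phi_affine a b m s : 0 < s ->
  ('E_(normal_prob m s)[fun y => Phi (a + b * y)] =
   (Phi ((a + b * m) / Num.sqrt (1 + (b * s) ^+ 2)))%:E)%E.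
Proof.
move=> s0; set t := Num.sqrt _.
have t0 : 0 < t by rewrite sqrtr_gt0 ltr_pwDl// sqr_ge0.
have mab : measurable_fun setT (fun y => a + b * y).
  by apply: measurable_funD => //; exact: measurable_funM.
rewrite unlock integral_normal_prob ?gt_eqF//; last 2 first.
- exact: (measurableT_comp measurable_Phi).
- by move=> x; exact: Phi_ge0_le1.
pose f (yz : R * R) := ((normal_pdf 0 1 (yz.2 + (a + b * yz.1)) *
  normal_pdf m s yz.1) * \1_(`]-oo, 0]) yz.2)%:E.
transitivity (\int[mu]_y \int[mu]_z f (y, z))%E.
  apply: eq_integral => y _; rewrite /f/= EFinM /Phi fineK ?fin_num_measure//.
  rewrite normal_prob_itvNy_shift -ge0_integralZr//; last 3 first.
  - apply/measurable_EFinP/measurable_funTS.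
    apply: measurableT_comp; first exact: measurable_normal_pdf.
    exact: measurable_funD.
  - by move=> z _; rewrite lee_fin normal_pdf_ge0.
  - by rewrite lee_fin normal_pdf_ge0.
  rewrite integral_mkcond; apply: eq_integral => z _.
  by rewrite patchE indicE; case: ifPn => _; rewrite ?mulr1 ?mulr0.
transitivity (\int[mu]_z \int[mu]_y f (y, z))%E.
  apply: (@fubini_tonelli _ _ _ _ R mu mu f).
- apply/measurable_EFinP/measurable_funM; last first.
    exact: (measurableT_comp (measurable_indic _)).
  apply: measurable_funM.
    apply: measurableT_comp; first exact: measurable_normal_pdf.
    by apply: measurable_funD => //; exact: (measurableT_comp mab).
  by apply: measurableT_comp => //; exact: measurable_normal_pdf.
- by move=> yz; rewrite lee_fin !mulr_ge0// normal_pdf_ge0.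
(* The conditional density integrates to 1 in [y], which leaves the marginal density in [z]. *)
transitivity (normal_prob (- (a + b * m)) t `]-oo, 0]).
  rewrite /normal_prob [RHS]integral_mkcond; apply: eq_integral => z _ /=.
  rewrite /f/= patchE indicE; case: ifPn => _; last first.
    by rewrite (_ : (fun _ => _) = cst 0%E) ?integral0//; apply/funext => y; rewrite mulr0.
  under eq_integral do rewrite mulr1 normal_pdf_mul// EFinM.
  rewrite ge0_integralZl//; last 3 first.
  - by apply/measurable_EFinP; exact: measurable_normal_pdf.
  - by move=> y _; rewrite lee_fin normal_pdf_ge0.
  - by rewrite lee_fin normal_pdf_ge0.
  by rewrite integral_normal_pdf mule1.
by rewrite normal_prob_itvNy// sub0r opprK /Phi fineK// fin_num_measure.
Qed.

End normal_law.

(** * The Gaussian tail and the maximum of [u ^+ 8 * Phi (- u) ^+ 3] *)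

Section gaussian_tail.
Context {R : realType}.
Local Open Scope classical_set_scope.
Implicit Types u v x : R.
Notation pdf := (@normal_pdf R 0 1).
Notation Phi := (@Phi R).

Lemma std_pdfE : pdf = fun u => (Num.sqrt (2 * pi))^-1 * expR (- (u ^+ 2 / 2)).
Proof.
by apply/funext => u; rewrite normal_pdf_gt0E// subr0 divr1 mul1r mulNr.
Qed.

Lemma sqrt_2pi_gt0 : 0 < Num.sqrt (2 * pi) :> R.
Proof. by rewrite sqrtr_gt0 mulr_gt0 ?pi_gt0. Qed.

Lemma std_pdf_gt0 u : 0 < pdf u.
Proof. by rewrite std_pdfE mulr_gt0 ?expR_gt0// invr_gt0 sqrt_2pi_gt0. Qed.

Lemma std_pdfN u : pdf (- u) = pdf u.
Proof. by rewrite std_pdfE sqrrN. Qed.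

Lemma is_derive_std_pdf u : is_derive u 1 pdf (- u * pdf u).
Proof.
rewrite std_pdfE; set c := _^-1.
have -> : (fun v => c * expR (- (v ^+ 2 / 2))) =
    c \*: (expR \o (fun v : R => - 2^-1 * v ^+ 2)).
  by apply/funext => v /=; rewrite mulNr [v ^+ 2 / 2]mulrC.
have dsq : is_derive u 1 (fun v : R => - 2^-1 * v ^+ 2) (- u).
  apply: (@is_derive_eq _ _ _ (- 2^-1 \*: (@id R ^+ 2)) u 1).
  by rewrite /GRing.scale/=; field.
apply: is_derive_eq; rewrite /GRing.scale/= mulNr [u ^+ 2 / 2]mulrC; ring.
Qed.

Lemma is_derive_Phi u : is_derive u 1 Phi (pdf u).
Proof.
have [||||d e] := @continuous_FTC1 R pdf (BInfty _ true) u (u + 1).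
- by rewrite ltrDl.
- exact: integrableS (integrable_normal_pdf 0 1).
- exact: ltNyr.
- by apply: continuous_normal_pdf; rewrite oner_eq0.
by apply: DeriveDef => //; rewrite -derive1E.
Qed.

Lemma continuous_Phi : continuous Phi.
Proof.
move=> x; apply/differentiable_continuous/derivable1_diffP.
by have := is_derive_Phi x => d; exact: ex_derive.
Qed.

Lemma Phi0 : Phi 0 = 2^-1.
Proof.
have H : (2%:E * normal_prob 0 1 `]-oo, (0 : R)%R])%E = 1%E.
  have cp : continuous pdf by apply: continuous_normal_pdf; rewrite oner_eq0.
  rewrite -(@integral_normal_pdf R 0 1) ge0_symfun_integralT//; last 2 first.
  - by move=> x; exact: normal_pdf_ge0.
  - by move=> x /=; rewrite std_pdfN.
  congr (_ * _)%E; rewrite /normal_prob -{1}oppr0.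
  rewrite ge0_integration_by_substitutionNy//; last 2 first.
  - exact: continuous_subspaceT.
  - by move=> x _; exact: normal_pdf_ge0.
  rewrite set_itvcy.
  by apply: eq_integral => x _ /=; rewrite std_pdfN.
have : (2%:E * (Phi 0)%:E)%E = 1%E :> \bar R.
  by rewrite /Phi fineK ?fin_num_measure.
by rewrite -EFinM => -[] e; lra.
Qed.

Lemma Phi_gt0 x : 0 < Phi x.
Proof.
have /andP[p0 _] := Phi_ge0_le1 (x - 1).
apply: le_lt_trans p0 _.
have [] := @MVT R Phi pdf (x - 1) x.
- by rewrite gtrBl.
- by move=> y _; exact: is_derive_Phi.
- by apply: continuous_subspaceT; exact: continuous_Phi.
move=> c _ e; have := std_pdf_gt0 c; lra.
Qed.

Lemma is_derive_tail u : is_derive u 1 (fun v => Phi (- v)) (- pdf u).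
Proof.
have d := is_derive_Phi (- u).
rewrite -[X in is_derive _ _ X]/(Phi \o -%R).
by apply: is_derive_eq; rewrite std_pdfN mulrN1.
Qed.

(* [pdf u / u - Phi (- u)] has derivative [- pdf u / u ^+ 2], so it decreases
   to its limit 0 at infinity. *)
Lemma tail_le u : 0 < u -> Phi (- u) <= pdf u / u.
Proof.
move=> u0; apply/ler_addgt0Pl => e e0.
pose D v := pdf v / v - Phi (- v).
have dD v : 0 < v -> is_derive v 1 D (- (pdf v / v ^+ 2)).
  move=> v0; have dp := is_derive_std_pdf v; have dt := is_derive_tail v.
  have v1 : v != 0 by rewrite gt_eqF.
  have dv := is_deriveV v1 (is_derive_id v (1 : R)).
  apply: (@is_derive_eq _ _ _ ((pdf * (fun v => v^-1)) - (fun v => Phi (- v))) v 1).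
  by rewrite /GRing.scale/=; field.
have [M [_ HM]] : \forall x \near -oo, Phi x < e.
  exact: (cvgr_lt (0 : R) (@cvg_PhiNy R)).
(* The term [1 - M] puts [- v] strictly below the threshold [M]. *)
pose v := Num.max (u + 1) (1 - M).
have uv : u < v by rewrite /v lt_max ltrDl ltr01.
have v0 : 0 < v by exact: lt_trans uv.
have Pv : Phi (- v) < e.
  have vM : 1 - M <= v by rewrite le_max lexx orbT.
  by apply: HM; lra.
have [] := @MVT R D (fun v => - (pdf v / v ^+ 2)) u v uv.
- by move=> y /itvP yuv; apply: dD; rewrite (lt_trans u0)// yuv.
- apply: derivable_within_continuous => y /itvP yuv.
  have y0 : 0 < y by rewrite (lt_le_trans u0)// yuv.
  by have := dD y y0 => d; exact: ex_derive.
move=> c /itvP cuv e1.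
have c0 : 0 < c by rewrite (lt_trans u0)// cuv.
have : D v <= D u.
  rewrite -subr_le0 e1 mulNr oppr_le0 mulr_ge0 ?subr_ge0 ?ltW//.
  by rewrite divr_gt0 ?exprn_gt0 ?std_pdf_gt0.
have : 0 < pdf v / v by rewrite divr_gt0 ?std_pdf_gt0.
rewrite /D; lra.
Qed.

(* Up to a positive factor, minus the derivative of [u ^+ 8 * Phi (- u) ^+ 3]. *)
Definition gap u := u * pdf u - 8 / 3 * Phi (- u).

Lemma is_derive_gap u : is_derive u 1 gap (pdf u * (11 / 3 - u ^+ 2)).
Proof.
have dp := is_derive_std_pdf u; have dt := is_derive_tail u.
apply: (@is_derive_eq _ _ _ ((@id R * pdf) - ((8 / 3) \*: (fun v => Phi (- v)))) u 1).
by rewrite /GRing.scale/=; field.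
Qed.

Lemma continuous_gap : continuous gap.
Proof.
move=> x; apply/differentiable_continuous/derivable1_diffP.
by have := is_derive_gap x => d; exact: ex_derive.
Qed.

Lemma gap_gt0 u : 0 < u -> 8 / 3 < u ^+ 2 -> 0 < gap u.
Proof.
move=> u0 hu; have t := tail_le u0; have p := std_pdf_gt0 u.
have : 0 < pdf u * (u ^+ 2 - 8 / 3) by rewrite mulr_gt0// subr_gt0.
have e : pdf u / u * u = pdf u by rewrite divfK// gt_eqF.
rewrite -(pmulr_lgt0 _ u0) /gap; nra.
Qed.

(** The derivative of [gap] has the sign of [11 / 3 - u ^+ 2], positive up to the threshold [8 / 3]
    at which [gap_gt0] takes over. *)
Lemma gap_lt u v : 0 <= u -> u < v -> v ^+ 2 <= 8 / 3 -> gap u < gap v.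
Proof.
move=> u0 uv hv; rewrite -subr_gt0.
have [||c /itvP cuv ->] := @MVT R gap (fun u => pdf u * (11 / 3 - u ^+ 2)) u v uv.
- by move=> y _; exact: is_derive_gap.
- by apply: continuous_subspaceT; exact: continuous_gap.
have cv : c < v by rewrite cuv.
have uc : u < c by rewrite cuv.
rewrite mulr_gt0 ?subr_gt0// mulr_gt0 ?std_pdf_gt0// subr_gt0; nra.
Qed.

(** By the mean value theorem, the sign of the difference is decided by the sign of [gap] at a point
    strictly between [u] and [v]. *)
Lemma tail_moment_max u v : 0 < u -> gap u = 0 -> 0 < v -> v != u ->
  v ^+ 8 * Phi (- v) ^+ 3 < u ^+ 8 * Phi (- u) ^+ 3.
Proof.
move=> u0 gu v0 vu; pose m v := v ^+ 8 * Phi (- v) ^+ 3.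
have dm x : is_derive x 1 m (- (3 * x ^+ 7 * Phi (- x) ^+ 2 * gap x)).
  have dt := is_derive_tail x.
  apply: (@is_derive_eq _ _ _ ((@id R ^+ 8) * ((fun v => Phi (- v)) ^+ 3)) x 1).
  by rewrite /GRing.scale/= /gap !fctE; field.
have cm a b : {within `[a, b], continuous m}.
  apply: derivable_within_continuous => y _.
  by have := dm y => d; exact: ex_derive.
(* No root lies where Mills' inequality makes [gap] positive. *)
have hu : u ^+ 2 <= 8 / 3.
  by rewrite leNgt; apply/negP => /(gap_gt0 u0); rewrite gu ltxx.
have pos x : 0 < x -> 0 < 3 * x ^+ 7 * Phi (- x) ^+ 2.
  by move=> x0; rewrite !mulr_gt0 ?exprn_gt0 ?Phi_gt0.
rewrite -subr_gt0 -/(m v) -/(m u).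
have [lt_vu|lt_uv|e] := ltgtP v u; last by rewrite e eqxx in vu.
- have [c /itvP cuv ->] := MVT lt_vu (fun x _ => dm x) (cm _ _).
  rewrite mulr_gt0 ?subr_gt0// oppr_gt0 pmulr_rlt0; last first.
    by rewrite pos// (lt_trans v0)// cuv.
  by rewrite -gu gap_lt// ?cuv// ltW// (lt_trans v0)// cuv.
- rewrite -opprB oppr_gt0.
  have [c /itvP cuv ->] := MVT lt_uv (fun x _ => dm x) (cm _ _).
  have uc : u < c by rewrite cuv.
  have c0 := lt_trans u0 uc.
  rewrite pmulr_llt0 ?subr_gt0// oppr_lt0 mulr_gt0 ?pos//.
  have [hc|hc] := leP (c ^+ 2) (8 / 3); last exact: gap_gt0.
  by rewrite -gu gap_lt// ltW.
Qed.

End gaussian_tail.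

(** * Alternating Taylor bounds and rational bounds for [pi] *)

Section taylor_bounds.
Context {R : realType}.
Implicit Types x y u : R.

Lemma ge0_derive (f df : R -> R) x : f 0 = 0 ->
  (forall y, is_derive y 1 f (df y)) -> (forall y, 0 <= y -> 0 <= df y) ->
  0 <= x -> 0 <= f x.
Proof.
move=> f0 dff df0 x0; suff : 0 <= f x - f 0 by rewrite f0 subr0.
have [|c /itvP cx ->] := @MVT_segment R f df 0 x x0 (fun y _ => dff y).
- apply: derivable_within_continuous => y _.
  by have := dff y => d; exact: ex_derive.
by rewrite subr0 mulr_ge0// df0// cx.
Qed.

(* Unlike [k`!%:R], this does not reduce, which lets the numerical sums below be
   expanded without computing with unary numbers. *)
Definition rfact k : R := \prod_(i < k) i.+1%:R.

Lemma rfact0 : rfact 0 = 1. Proof. by rewrite /rfact big_ord0. Qed.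

Lemma rfactS k : rfact k.+1 = k.+1%:R * rfact k.
Proof. by rewrite /rfact big_ord_recr mulrC. Qed.

Lemma rfact_neq0 k : rfact k != 0.
Proof. by apply/prodf_neq0 => i _; rewrite pnatr_eq0. Qed.

Definition expRN_taylor n y := \sum_(k < n.+1) (- y) ^+ k / rfact k.

Lemma is_derive_expRN_taylor n y :
  is_derive y 1 (expRN_taylor n.+1) (- expRN_taylor n y).
Proof.
elim: n => [|n IH].
  have -> : expRN_taylor 1 = cst 1 - id.
    apply/funext => z; rewrite /expRN_taylor !big_ord_recr big_ord0/=.
    by rewrite !fctE add0r rfactS rfact0 mulr1 !divr1.
  by apply: is_derive_eq; rewrite /expRN_taylor big_ord1 rfact0 sub0r divr1.
have -> : expRN_taylor n.+2 = expRN_taylor n.+1 +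
    ((rfact n.+2)^-1) \*: ((- id) ^+ n.+2).
  apply/funext => z; rewrite /expRN_taylor big_ord_recr.
  by congr (_ + _); rewrite !fctE [LHS]mulrC.
apply: is_derive_eq; rewrite [in RHS]/expRN_taylor big_ord_recr/= !fctE.
rewrite opprD -/(expRN_taylor n y); congr (_ + _).
rewrite rfactS /GRing.scale/=.
by field; rewrite rfact_neq0 -natrD pnatr_eq0.
Qed.

(** Induction on the degree: the signed error vanishes at 0, and its derivative is the signed error
    one degree lower. Even degrees bound from above, odd ones from below. *)
Lemma expRN_taylor_bound n y : 0 <= y ->
  0 <= (-1) ^+ n * (expRN_taylor n y - expR (- y)).
Proof.
elim: n y => [|n IH] y y0.
  rewrite /expRN_taylor big_ord1 !expr0 rfact0 divr1 mul1r subr_ge0 -expR0 ler_expR.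
  by rewrite oppr_le0.
pose f y := (-1) ^+ n.+1 * (expRN_taylor n.+1 y - expR (- y)).
apply: (@ge0_derive f (fun y => (-1) ^+ n * (expRN_taylor n y - expR (- y)))) => //.
- rewrite /f /expRN_taylor big_ord_recl/= big1 => [|i _].
    by rewrite oppr0 expR0 rfact0 divr1 addr0 subrr mulr0.
  by rewrite /bump/= add1n oppr0 exprS !mul0r.
- move=> z; have d := is_derive_expRN_taylor n z.
  have -> : f = (-1) ^+ n.+1 \*: (expRN_taylor n.+1 - (expR \o -%R)) by [].
  apply: is_derive_eq; rewrite /GRing.scale/= exprS; ring.
Qed.

(** Termwise integral of [expRN_taylor n (v ^+ 2 / 2)] for [v] from 0 to [u]. *)
Definition gauss_taylor n u :=
  u * \sum_(k < n.+1) (- (u ^+ 2 / 2)) ^+ k / rfact k / (k.*2.+1)%:R.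

Lemma is_derive_gauss_taylor n u :
  is_derive u 1 (gauss_taylor n) (expRN_taylor n (u ^+ 2 / 2)).
Proof.
have dterm k : is_derive u 1
    (fun u => u * ((- (u ^+ 2 / 2)) ^+ k / rfact k / (k.*2.+1)%:R))
    ((- (u ^+ 2 / 2)) ^+ k / rfact k).
  pose c : R := (- 2^-1) ^+ k / rfact k / (k.*2.+1)%:R.
  have -> : (fun u => u * ((- (u ^+ 2 / 2)) ^+ k / rfact k / (k.*2.+1)%:R)) =
      c \*: (@id R ^+ k.*2.+1).
    apply/funext => z; rewrite !fctE -[RHS]/(c * z ^+ k.*2.+1) /c.
    rewrite [in RHS]exprS -mul2n exprM -[- (z ^+ 2 / 2)]mulrN mulrC exprMn; ring.
  apply: is_derive_eq; rewrite /c /GRing.scale/= -[- (u ^+ 2 / 2)]mulrN.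
  rewrite mulr1 -mul2n exprM !exprMn.
  by field; rewrite rfact_neq0 -natrM nat1r pnatr_eq0.
rewrite /expRN_taylor; elim: n => [|n IH].
  have -> : gauss_taylor 0 =
      (fun u => u * ((- (u ^+ 2 / 2)) ^+ 0 / rfact 0 / (0.*2.+1)%:R)).
    by apply/funext => z; rewrite /gauss_taylor big_ord1.
  by rewrite big_ord1; exact: dterm.
have -> : gauss_taylor n.+1 = gauss_taylor n +
  (fun u => u * ((- (u ^+ 2 / 2)) ^+ n.+1 / rfact n.+1 / (n.+1.*2.+1)%:R)).
  by apply/funext => z; rewrite /gauss_taylor big_ord_recr/= mulrDr.
by rewrite big_ord_recr/=; have d := dterm n.+1; exact: is_deriveD.
Qed.

(** The subtracted term is the integral of [expR (- (v ^+ 2 / 2))] from 0 to [u], so the bounds for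
    the exponential are integrated. *)
Lemma gauss_taylor_bound n u : 0 <= u ->
  0 <= (-1) ^+ n * (gauss_taylor n u - Num.sqrt (2 * pi) * (2^-1 - Phi (- u))).
Proof.
pose g u := Num.sqrt (2 * pi) * (2^-1 - Phi (- u) : R).
apply: (@ge0_derive (fun u => (-1) ^+ n * (gauss_taylor n u - g u))
  (fun u => (-1) ^+ n * (expRN_taylor n (u ^+ 2 / 2) - expR (- (u ^+ 2 / 2))))).
- by rewrite /gauss_taylor mul0r /g oppr0 Phi0 subrr mulr0 subr0 mulr0.
- move=> y; have dg := is_derive_gauss_taylor n y; have dt := is_derive_tail y.
  rewrite -[X in is_derive _ _ X]/((-1) ^+ n \*: (gauss_taylor n -
    Num.sqrt (2 * pi) \*: (cst 2^-1 - (fun v => Phi (- v))))).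
  apply: is_derive_eq; rewrite sub0r opprK std_pdfE /GRing.scale/=.
  by rewrite mulrA divff ?gt_eqF ?sqrt_2pi_gt0// mul1r.
- by move=> y y0; apply: expRN_taylor_bound; rewrite divr_ge0 ?sqr_ge0.
Qed.

Definition cos_taylor n x : R := \sum_(k < n.+1) (-1) ^+ k * x ^+ k.*2 / rfact (k.*2).
Definition sin_taylor n x : R :=
  \sum_(k < n.+1) (-1) ^+ k * x ^+ k.*2.+1 / rfact (k.*2.+1).

Lemma is_derive_sin_taylor n x : is_derive x 1 (sin_taylor n) (cos_taylor n x).
Proof.
have dterm k : is_derive x 1 (fun x : R => (-1) ^+ k * x ^+ k.*2.+1 / rfact (k.*2.+1))
    ((-1) ^+ k * x ^+ k.*2 / rfact (k.*2)).
  have -> : (fun x : R => (-1) ^+ k * x ^+ k.*2.+1 / rfact (k.*2.+1)) =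
      ((-1) ^+ k / rfact (k.*2.+1) : R) \*: (@id R ^+ k.*2.+1).
    by apply/funext => z; rewrite !fctE /GRing.scale/= mulrAC.
  apply: is_derive_eq; rewrite /GRing.scale/= rfactS.
  by field; rewrite rfact_neq0 nat1r pnatr_eq0.
elim: n => [|n IH].
  have -> : sin_taylor 0 = (fun x : R => (-1) ^+ 0 * x ^+ 0.*2.+1 / rfact (0.*2.+1)).
    by apply/funext => z; rewrite /sin_taylor big_ord1.
  by rewrite /cos_taylor big_ord1; exact: dterm.
have -> : sin_taylor n.+1 = sin_taylor n +
    (fun x : R => (-1) ^+ n.+1 * x ^+ n.+1.*2.+1 / rfact (n.+1.*2.+1)).
  by apply/funext => z; rewrite /sin_taylor big_ord_recr.
by rewrite /cos_taylor big_ord_recr/=; have d := dterm n.+1; exact: is_deriveD.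
Qed.

Lemma is_derive_cos_taylor n x :
  is_derive x 1 (cos_taylor n.+1) (- sin_taylor n x).
Proof.
have dterm k : is_derive x 1 (fun x : R => (-1) ^+ k.+1 * x ^+ k.+1.*2 / rfact (k.+1.*2))
    (- ((-1) ^+ k * x ^+ k.*2.+1 / rfact (k.*2.+1))).
  have -> : (fun x : R => (-1) ^+ k.+1 * x ^+ k.+1.*2 / rfact (k.+1.*2)) =
      ((-1) ^+ k.+1 / rfact (k.+1.*2) : R) \*: (@id R ^+ k.+1.*2).
    by apply/funext => z; rewrite !fctE /GRing.scale/= mulrAC.
  apply: is_derive_eq; rewrite /GRing.scale/= doubleS/= rfactS [_ ^+ k.+1]exprS.
  by field; rewrite rfact_neq0 -natrD pnatr_eq0.
elim: n => [|n IH].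
  have -> : cos_taylor 1 = cst 1 +
      (fun x : R => (-1) ^+ 1 * x ^+ 1.*2 / rfact (1.*2)).
    by apply/funext => z; rewrite /cos_taylor big_ord_recr big_ord1/= mul1r rfact0 divr1.
  have d := dterm 0; apply: is_derive_eq.
  by rewrite add0r /sin_taylor big_ord1.
have -> : cos_taylor n.+2 = cos_taylor n.+1 +
    (fun x : R => (-1) ^+ n.+2 * x ^+ n.+2.*2 / rfact (n.+2.*2)).
  by apply/funext => z; rewrite /cos_taylor big_ord_recr.
by rewrite /sin_taylor big_ord_recr/= opprD; have d := dterm n.+1; exact: is_deriveD.
Qed.

(** Starting from [cos x <= 1], integration turns each cosine bound into the sine bound of the same
    index, and that one into the next cosine bound. *)
Lemma cos_taylor_bound n x : 0 <= x -> 0 <= (-1) ^+ n * (cos_taylor n x - cos x).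
Proof.
have sin_bound m : (forall y, 0 <= y -> 0 <= (-1) ^+ m * (cos_taylor m y - cos y)) ->
    forall y, 0 <= y -> 0 <= (-1) ^+ m * (sin_taylor m y - sin y).
  move=> IH y; apply: (@ge0_derive (fun y => (-1) ^+ m * (sin_taylor m y - sin y))
    (fun y => (-1) ^+ m * (cos_taylor m y - cos y))) => //.
  - rewrite /sin_taylor big1 => [|i _]; first by rewrite sin0 subrr mulr0.
    by rewrite exprS mul0r mulr0 mul0r.
  - move=> z; have d := is_derive_sin_taylor m z.
    rewrite -[X in is_derive _ _ X]/((-1) ^+ m \*: (sin_taylor m - sin)).
    exact: is_derive_eq.
elim: n x => [|n IH] x.
  by rewrite /cos_taylor big_ord1 double0 !expr0 !mul1r rfact0 invr1 subr_ge0 cos_le1.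
apply: (@ge0_derive (fun y => (-1) ^+ n.+1 * (cos_taylor n.+1 y - cos y))
  (fun y => (-1) ^+ n * (sin_taylor n y - sin y))).
- rewrite /cos_taylor big_ord_recl/= big1 => [|i _].
    by rewrite cos0 mul1r rfact0 divr1 addr0 subrr mulr0.
  by rewrite /bump/= add1n doubleS [0 ^+ _]exprS mul0r mulr0 mul0r.
- move=> z; have d := is_derive_cos_taylor n z.
  rewrite -[X in is_derive _ _ X]/((-1) ^+ n.+1 \*: (cos_taylor n.+1 - cos)).
  by apply: is_derive_eq; rewrite /GRing.scale/= exprS; ring.
- exact: sin_bound.
Qed.

(** [cos] changes sign at [pi / 2]: its lower Taylor bound is positive at [344 / 219], its upper one
    negative at [355 / 226]. *)
Lemma pi_bounds : 688 / 219 < pi :> R /\ pi < 355 / 113 :> R.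
Proof.
split; rewrite ltNge; apply/negP => h.
- have cle0 : cos (344 / 219) <= 0 :> R.
    have p2 := @pi_ge2 R.
    rewrite leNgt; apply/negP; rewrite -cos_pihalf ltr_cos ?in_itv/=; last 2 first.
    - by apply/andP; split; lra.
    - by apply/andP; split; lra.
    by lra.
  have := @cos_taylor_bound 5 (344 / 219).
  rewrite /cos_taylor !big_ord_recr big_ord0/= !doubleS !double0 !rfactS !rfact0 => hb.
  lra.
- have c0 : 0 <= cos (355 / 226) :> R.
    by apply: cos_ge0_pihalf; apply/andP; split; lra.
  have := @cos_taylor_bound 6 (355 / 226).
  rewrite /cos_taylor !big_ord_recr big_ord0/= !doubleS !double0 !rfactS !rfact0 => hb.
  lra.
Qed.

End taylor_bounds.

(** * Location of the root, closed form of the acceptance rate, AM-GM *)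

Section optimum.
Context {R : realType}.
Local Open Scope classical_set_scope.
Implicit Types (K l u a y : R).

Let s : R := Num.sqrt (2 * pi).

Let s_gt0 : 0 < s. Proof. exact: sqrt_2pi_gt0. Qed.

Lemma sqrt_2pi_bounds : 3033 / 1210 < s < 945 / 377.
Proof.
have [p1 p2] := @pi_bounds R.
have s2 : s ^+ 2 = 2 * pi by rewrite sqr_sqrtr// mulr_ge0 ?pi_ge0.
have sp := s_gt0.
apply/andP; split; rewrite ltNge; apply/negP => h.
(* The difference of squares brings in [s ^+ 2 = 2 * pi], so that linear arithmetic suffices. *)
- have : 0 <= (3033 / 1210 - s) * (3033 / 1210 + s) by apply: mulr_ge0; lra.
  lra.
- have : 0 <= (s - 945 / 377) * (s + 945 / 377) by apply: mulr_ge0; lra.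
  lra.
Qed.

(** Scaling by [s] keeps the sign and leaves a combination of the three quantities that have been
    bounded: the exponential, the Gaussian integral and [s]. *)
Lemma gap_scaled u : s * gap u =
  u * expR (- (u ^+ 2 / 2)) + 8 / 3 * (s * (2^-1 - Phi (- u))) - 4 / 3 * s.
Proof.
rewrite /gap std_pdfE -/s; have s0 : s != 0 by rewrite gt_eqF ?s_gt0.
by field.
Qed.

(** The even degree 8 bounds the exponential and the integral from above; [s] enters negatively,
    through its lower bound. *)
Lemma gap_lower_lt0 : gap (454 / 319 : R) < 0.
Proof.
rewrite -(pmulr_rlt0 _ s_gt0) gap_scaled.
have /andP[sl su] := sqrt_2pi_bounds.
have u0 : 0 <= 454 / 319 :> R by lra.
have z0 : 0 <= (454 / 319) ^+ 2 / 2 :> R by lra.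
have hE := expRN_taylor_bound 8 z0.
have hG := @gauss_taylor_bound R 8 _ u0.
move: hE hG; rewrite -/s /expRN_taylor /gauss_taylor.
rewrite !big_ord_recr !big_ord0/= !doubleS !double0 !rfactS !rfact0.
set E := expR _; set G := s * (_ - _) => hE hG.
lra.
Qed.

Lemma gap_upper_gt0 : 0 < gap (306 / 215 : R).
Proof.
rewrite -(pmulr_rgt0 _ s_gt0) gap_scaled.
have /andP[sl su] := sqrt_2pi_bounds.
have u0 : 0 <= 306 / 215 :> R by lra.
have z0 : 0 <= (306 / 215) ^+ 2 / 2 :> R by lra.
have hE := expRN_taylor_bound 9 z0.
have hG := @gauss_taylor_bound R 9 _ u0.
move: hE hG; rewrite -/s /expRN_taylor /gauss_taylor.
rewrite !big_ord_recr !big_ord0/= !doubleS !double0 !rfactS !rfact0.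
set E := expR _; set G := s * (_ - _) => hE hG.
lra.
Qed.

(** The bracket is narrow enough for every displayed digit: in particular [3 / 2 * (306 / 215) ^+ 2]
    is about 3.03849, just below 3.0385. *)
Lemma gap_root : exists2 u : R, 454 / 319 < u < 306 / 215 & gap u = 0.
Proof.
have l0 := gap_lower_lt0; have g0 := gap_upper_gt0.
have [|||c /itvP cu gc] := @IVT R gap (454 / 319) (306 / 215) 0.
- by lra.
- by apply: continuous_subspaceT; exact: continuous_gap.
- by rewrite ge_min le_max (ltW l0) (ltW g0) orbT.
exists c => //; rewrite !lt_neqAle !cu !andbT; apply/andP; split.
- by apply/eqP => e; rewrite e gc ltxx in l0.
- by apply/eqP => e; rewrite -e gc ltxx in g0.
Qed.

(** At a root the tail is a multiple of [u] times the density, so bounds for the exponential and [s]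
    suffice. *)
Lemma tail_at_root u : 454 / 319 < u < 306 / 215 -> gap u = 0 ->
  1547 / 10 ^+ 4 - 5 / 10 ^+ 5 < 2 * Phi (- u) < 1547 / 10 ^+ 4 + 5 / 10 ^+ 5.
Proof.
move=> /andP[ul uu] gu; have /andP[sl su] := sqrt_2pi_bounds.
set E := expR (- (u ^+ 2 / 2)).
have tE : s * (2 * Phi (- u)) = 3 / 4 * (u * E).
  have : s * gap u = 0 by rewrite gu mulr0.
  rewrite /gap std_pdfE -/s -/E; have s0 : s != 0 by rewrite gt_eqF ?s_gt0.
  have -> : s * (u * (s^-1 * E) - 8 / 3 * Phi (- u)) =
      u * E - 8 / 3 * (s * Phi (- u)) by field.
  by move=> ?; lra.
have El : 73 / 201 < E.
  have z0 : 0 <= (306 / 215) ^+ 2 / 2 :> R by lra.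
  have := expRN_taylor_bound 9 z0.
  rewrite /expRN_taylor !big_ord_recr !big_ord0/= !rfactS !rfact0.
  have : expR (- ((306 / 215) ^+ 2 / 2)) < E by rewrite ltr_expR; nra.
  lra.
have Eu : E < 109 / 300.
  have z0 : 0 <= (454 / 319) ^+ 2 / 2 :> R by lra.
  have := expRN_taylor_bound 8 z0.
  rewrite /expRN_taylor !big_ord_recr !big_ord0/= !rfactS !rfact0.
  have : E < expR (- ((454 / 319) ^+ 2 / 2)) by rewrite ltr_expR; nra.
  lra.
have uE1 : 0 < (u - 454 / 319) * E by apply: mulr_gt0; lra.
have uE2 : 0 < (306 / 215 - u) * E by apply: mulr_gt0; lra.
have {uE1} lb : 3 / 4 * (454 / 319 * (73 / 201)) < s * (2 * Phi (- u)).
  by rewrite tE; lra.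
have {uE2} ub : s * (2 * Phi (- u)) < 3 / 4 * (306 / 215 * (109 / 300)).
  by rewrite tE; lra.
clear gu ul uu El Eu; apply/andP; split; rewrite -(ltr_pM2l s_gt0).
- by apply: le_lt_trans lb; lra.
- by apply: lt_le_trans ub _; lra.
Qed.

(** With [W ^+ 2 = x ^+ 2 + 2 * s2], the numerator [- (x / 2) - s2 / x] is [- W ^+ 2 / (2 * x)] and
    the standard deviation is [W / x]; their quotient is [- W / 2]. *)
Lemma alphaE K l (s2 : R) : 0 < K -> 0 < l -> 0 < s2 ->
  alpha K l s2 = 2 * Phi (- (Num.sqrt ((l ^+ 3 * K) ^+ 2 + 2 * s2) / 2)).
Proof.
move=> K0 l0 s20; rewrite /alpha; set x := l ^+ 3 * K.
have x0 : 0 < x by rewrite mulr_gt0 ?exprn_gt0.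
have -> : (fun b => Phi (b / x - x / 2)) = (fun y => Phi (- (x / 2) + x^-1 * y)).
  by apply/funext => b; rewrite addrC [b / x]mulrC.
rewrite expectation_Phi_affine ?sqrtr_gt0 ?mulr_gt0//=; congr (2 * Phi _).
set W := Num.sqrt (x ^+ 2 + _).
have W2 : W ^+ 2 = x ^+ 2 + 2 * s2 by rewrite sqr_sqrtr// addr_ge0 ?sqr_ge0 ?mulr_ge0 ?ltW.
have W0 : 0 < W by rewrite sqrtr_gt0 ltr_pwDl ?exprn_gt0 ?mulr_ge0 ?ltW.
have -> : 1 + (x^-1 * Num.sqrt (2 * s2)) ^+ 2 = (W / x) ^+ 2.
  rewrite !exprMn sqr_sqrtr ?mulr_ge0 ?ltW// W2 exprVn.
  by field; rewrite gt_eqF.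
rewrite sqrtr_sqr gtr0_norm ?divr_gt0//.
have -> : s2 = (W ^+ 2 - x ^+ 2) / 2 by rewrite W2; field.
by field; rewrite !gt_eqF.
Qed.

(** The difference of the two sides is [(y - a) ^+ 2] times a positive quadratic form, which also
    settles the equality case. *)
Lemma amgm3 a y : 0 < a -> 0 < y -> a ^+ 3 * y <= ((3 * a + y) / 4) ^+ 4 ?= iff (a == y).
Proof.
move=> a0 y0.
pose q := (y ^+ 2 + 14 * a * y + 81 * a ^+ 2) / 256.
have e : ((3 * a + y) / 4) ^+ 4 - a ^+ 3 * y = (y - a) ^+ 2 * q.
  by rewrite /q; field.
have q0 : 0 < q by rewrite divr_gt0// !addr_gt0 ?mulr_gt0 ?exprn_gt0.
split; first by rewrite -subr_ge0 e mulr_ge0 ?sqr_ge0// ltW.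
rewrite [RHS]eq_sym -[RHS]subr_eq0 [LHS]eq_sym -[LHS]subr_eq0 e.
by rewrite mulf_eq0 sqrf_eq0 (gt_eqF q0) orbF.
Qed.

(** Cubing turns [l ^+ 2] into [l ^+ 6], which [K ^+ 2] completes to a square; the factor [2 / 3]
    places the equality case of [amgm3] at equal arguments. *)
Lemma Eff_cube K l (s2 : R) : 0 < K -> 0 < l -> 0 < s2 ->
  let w := Num.sqrt ((l ^+ 3 * K) ^+ 2 + 2 * s2) / 2 in
  K ^+ 2 * Eff K l s2 ^+ 3 =
  27 * ((2 * s2 / 3) ^+ 3 * (l ^+ 3 * K) ^+ 2 * Phi (- w) ^+ 3).
Proof. by move=> K0 l0 s20 w; rewrite /Eff alphaE// -/w; field. Qed.

End optimum.

(** * The optimum, its uniqueness and its digits *)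

Theorem corollary3p2 (R : realType) (K : R) (hK : 0 < K) :
  exists l_opt s2_opt : R,
    [/\ 0 < l_opt /\ 0 < s2_opt,
        (forall l s2 : R, 0 < l -> 0 < s2 -> (l, s2) <> (l_opt, s2_opt) ->
           Eff K l s2 < Eff K l_opt s2_opt),
        `|l_opt / K `^ (- 3^-1) - 1125 / 10 ^+ 3| < 5 / 10 ^+ 4,
        `|s2_opt - 3038 / 10 ^+ 3| < 5 / 10 ^+ 4
      & `|alpha K l_opt s2_opt - 1547 / 10 ^+ 4| < 5 / 10 ^+ 5].
Proof.
have [u /andP[ul uu] gu] := @gap_root R.
have u0 : 0 < u by lra.
pose r := u `^ 3^-1; pose k := K `^ (- 3^-1).
have r0 : 0 < r by rewrite powR_gt0.
have k0 : 0 < k by rewrite powR_gt0.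
have r3 : r ^+ 3 = u by rewrite /r -powR_mulrn ?powR_ge0// -powRrM mulVf// powRr1 ?ltW.
have k3 : k ^+ 3 * K = 1.
  rewrite /k -powR_mulrn ?powR_ge0// -powRrM mulNr mulVf// powRN powRr1 ?ltW//.
  by rewrite mulVf// gt_eqF.
(* The equality case of AM-GM, taken at [w = u]. *)
pose l := r * k; pose s2 := 3 / 2 * u ^+ 2.
have l0 : 0 < l by rewrite mulr_gt0.
have s20 : 0 < s2 by rewrite mulr_gt0 ?exprn_gt0// divr_gt0.
have x_opt : l ^+ 3 * K = u by rewrite exprMn -mulrA k3 mulr1 r3.
have w_opt : Num.sqrt ((l ^+ 3 * K) ^+ 2 + 2 * s2) / 2 = u.
  have -> : (l ^+ 3 * K) ^+ 2 + 2 * s2 = (2 * u) ^+ 2 by rewrite x_opt /s2; field.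
  by rewrite sqrtr_sqr gtr0_norm ?mulr_gt0// mulrC mulKf.
exists l, s2; split => //.
- move=> l' s2' l'0 s2'0 ne.
  have Eff_ge0 (l1 s1 : R) : 0 < l1 -> 0 < s1 -> 0 <= Eff K l1 s1.
    move=> l10 s10; rewrite /Eff alphaE// !mulr_ge0 ?exprn_ge0 ?ltW//.
    exact: Phi_gt0.
  rewrite -(@ltr_pXn2r _ 3) ?nnegrE ?Eff_ge0//.
  rewrite -(ltr_pM2l (exprn_gt0 2 hK)) !Eff_cube// w_opt x_opt.
  set w := Num.sqrt _ / 2; set a := 2 * s2' / 3; set y := (l' ^+ 3 * K) ^+ 2.
  have a0 : 0 < a by rewrite divr_gt0 ?mulr_gt0.
  have y0 : 0 < y by rewrite exprn_gt0// mulr_gt0 ?exprn_gt0.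
  have w2 : (3 * a + y) / 4 = w ^+ 2.
    rewrite /w exprMn sqr_sqrtr; first by rewrite /a /y; field.
    by rewrite addr_ge0 ?sqr_ge0 ?mulr_ge0 ?ltW.
  have w0 : 0 < w.
    by rewrite divr_gt0// sqrtr_gt0 addr_gt0 ?mulr_gt0 ?exprn_gt0 ?mulr_gt0 ?exprn_gt0.
  have -> : (2 * s2 / 3) ^+ 3 * u ^+ 2 = u ^+ 8 by rewrite /s2; field.
  have am := amgm3 a0 y0; rewrite w2 -exprM in am.
  rewrite ltr_pM2l//.
  (* Strictness comes from the tail function when [w] differs from [u]. Otherwise it comes from
     AM-GM, whose equality case would force the optimal pair. *)
  have [wu|wu] := eqVneq w u; last first.
    apply: le_lt_trans (tail_moment_max u0 gu w0 wu).
    by rewrite ler_pM2r ?exprn_gt0 ?Phi_gt0// am.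
  rewrite wu ltr_pM2r ?exprn_gt0 ?Phi_gt0//.
  rewrite wu in am w2; rewrite lt_neqAle am.2 am.1 andbT.
  apply/eqP => ay; apply: ne.
  have yu : y = u ^+ 2 by rewrite -w2 ay; field.
  have lK : l' ^+ 3 * K = u.
    apply/eqP; rewrite -(@eqrXn2 _ 2) ?ltW ?mulr_gt0 ?exprn_gt0//; exact/eqP.
  congr (_, _).
    apply/eqP; rewrite -(@eqrXn2 _ 3) ?ltW//.
    by rewrite -(inj_eq (mulIf (lt0r_neq0 hK))) lK x_opt.
  by rewrite /s2 -yu -ay /a; field.
(* The cubes of 1.1245 and 1.1255 enclose the bracket of [u = r ^+ 3]. *)
- have -> : l / K `^ (- 3^-1) = r by rewrite /l mulfK ?gt_eqF.
  have rl : 1124 / 10 ^+ 3 + 5 / 10 ^+ 4 < r.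
    rewrite ltNge; apply/negP => h.
    have : r ^+ 3 <= (1124 / 10 ^+ 3 + 5 / 10 ^+ 4) ^+ 3.
      by apply: lerXn2r; rewrite ?nnegrE; lra.
    by rewrite r3; lra.
  have ru : r < 1125 / 10 ^+ 3 + 5 / 10 ^+ 4.
    rewrite ltNge; apply/negP => h.
    have : (1125 / 10 ^+ 3 + 5 / 10 ^+ 4) ^+ 3 <= r ^+ 3.
      by apply: lerXn2r; rewrite ?nnegrE; lra.
    by rewrite r3; lra.
  by clear ul uu; rewrite ltr_distl; apply/andP; split; lra.
- have u2l : (454 / 319) ^+ 2 < u ^+ 2 by nra.
  have u2u : u ^+ 2 < (306 / 215) ^+ 2 by nra.
  by rewrite /s2 ltr_distl; apply/andP; split; lra.
- rewrite alphaE// w_opt ltr_distl; apply: tail_at_root => //.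
  by rewrite ul uu.
Qed.
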